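(* Let $(X,T)$ be a topological dynamical system admitting a one-sided $N$-order horseshoe $(\Lambda,T^N)$, for some integer $N\ge1$. Then there exist a closed subset $K\subset\Lambda$ and a positive integer $M$ such that $(K,T^{MN})$ is a one-sided horseshoe of $(X,T)$ with disjoint steps.
   Context: A topological dynamical system $(X,T)$ is a compact metric space $X$ together with a continuous map $T:X\to X$. For an integer $N\ge1$, a one-sided $N$-order horseshoe of $(X,T)$ is a pair $(\Lambda,T^N)$ where $\Lambda\subset X$ is closed, $T^N(\Lambda)\subset\Lambda$, and $(\Lambda,T^N)$ is topologically conjugate to the one-sided full shift $(\{0,1\}^{\mathbb N},\sigma)$, where $\mathbb N=\{0,1,2,\dots\}$ and $\sigma((x_n)_{n\ge0})=(x_{n+1})_{n\ge0}$. An $N$-order horseshoe $(\Lambda,T^N)$ has disjoint steps if $\Lambda\cap\bigcup_{k=1}^{N-1}T^k(\Lambda)=\emptyset$. (Thus the pair $(K,T^{MN})$ is an $MN$-order horseshoe, and it has disjoint steps if $K\cap T^k(K)=\emptyset$ for $1\le k\le MN-1$.) *)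

(* Defs.v *)
From mathcomp Require Import all_boot all_order all_algebra.
From mathcomp Require Import all_classical all_reals all_analysis.

Set Implicit Arguments.
Unset Strict Implicit.
Unset Printing Implicit Defensive.

Local Open Scope classical_set_scope.

(* One-sided sequences over [bool] stand for {0,1}^N; [cantor_space] carries
   the product of the discrete topologies. *)
Definition shift (x : cantor_space) : cantor_space := fun n => x n.+1.

Definition topological_dynamical_system
    (R : realType) (X : metricType R) (T : X -> X) : Prop :=
  compact [set: X] /\ continuous T.

(* [h] restricted to [L] is a homeomorphism of the subspace [L] onto [Y], with
   inverse [k], and it intertwines [f] and [g]. The values of [h] outside [L]
   are irrelevant; [Y] is pointed so that every map defined on [L] extends to
   a total function. *)
Definition topologically_conjugate
    (X : topologicalType) (L : set X) (f : X -> X)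
    (Y : ptopologicalType) (g : Y -> Y) : Prop :=
  exists (h : X -> Y) (k : Y -> X),
    [/\ {within L, continuous h}, continuous k & forall y, L (k y)] /\
    [/\ forall x, L x -> k (h x) = x,
        forall y, h (k y) = y &
        forall x, L x -> h (f x) = g (h x)].

(* [horseshoe N T L]: the pair (L, T^N) is a one-sided N-order horseshoe. *)
Definition horseshoe
    (X : topologicalType) (N : nat) (T : X -> X) (L : set X) : Prop :=
  [/\ closed L, iter N T @` L `<=` L &
      topologically_conjugate L (iter N T) shift].

Definition disjoint_steps (X : Type) (N : nat) (T : X -> X) (L : set X) : Prop :=
  L `&` \bigcup_(k in [set k | (1 <= k <= N - 1)%N]) (iter k T @` L) = set0.

(* Main.v *)
(* Let S be the restriction of T^N to L, and let x in L correspond to the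
   periodic sequence of period p with N | p. If T^n x = x then S^n x = x, so
   p | n and N | n: x does not return at a time n not
   divisible by N, and by continuity neither does a long cylinder around it.
   K consists of the sequences built from two blocks of length M that both
   follow x for most of their length and carry a marker. If T^k y = y' with y, y'
   in K, a suitable iterate of S brings both y and y' close to the S-orbit of x,
   which forces N | k; then T^k is a power of S on L, and the markers force
   MN | k. *)

Require Import Defs.
From mathcomp Require Import all_boot all_order all_algebra.
From mathcomp Require Import all_classical all_reals all_analysis.
From mathcomp Require Import zify.

Set Implicit Arguments.
Unset Strict Implicit.

Local Open Scope classical_set_scope.

(* MathComp-Analysis has another [shift]. *)
Local Notation shift := Defs.shift.

(** * Topology of the Cantor space through finite prefixes *)

Lemma cantor_cvgP (U : Type) (F : set_system U) (z : U -> cantor_space)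
    (x : cantor_space) : Filter F ->
  z @ F --> x <-> (forall n, \forall u \near F, z u n = x n).
Proof.
move=> FF; split=> [zx n|zx].
  have H := (@pointwise_cvgP nat bool (z @ F) x _).1 zx n.
  have /H : nbhs (x n) [set x n] by exact: discrete_set1.
  by [].
apply/(@pointwise_cvgP nat bool (z @ F) x _) => n A /nbhs_singleton Axn.
by apply: filterS (zx n) => u /= ->.
Qed.

Lemma cantor_continuousP (f : cantor_space -> cantor_space) :
  (forall n, exists m, forall x y, (forall i, (i < m)%N -> x i = y i) ->
     f x n = f y n) -> continuous f.
Proof.
move=> fP x; apply/cantor_cvgP => n; have [m fm] := fP n.
have xid : (id : cantor_space -> cantor_space) @ x --> x by exact: cvg_id.
have /= H := (@cantor_cvgP _ _ _ x _).1 xid.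
have {}H : \forall y \near nbhs x, forall i : 'I_m, y (i : nat) = x (i : nat).
  by apply: filter_forall => i; exact: (H _ i).
apply: filterS H => y yx; apply: fm => i im.
exact: (yx (Ordinal im)).
Qed.

(** Otherwise points outside [U] that agree with [x] on longer and longer prefixes would converge to
    [x]. *)
Lemma cylinder_sub_nbhs (x : cantor_space) (U : set cantor_space) :
  nbhs x U -> exists b, forall z, (forall n, (n < b)%N -> z n = x n) -> U z.
Proof.
move=> xU; apply: contrapT => /forallNP H.
have {}H b : exists z, (forall n, (n < b)%N -> z n = x n) /\ ~ U z.
  by have /existsNP[z /not_implyP] := H b; exists z.
have [z zP] := choice H.
have zx : z @ \oo --> x.
  apply/cantor_cvgP => n; exists n.+1 => // m /= nm.
  by have [+ _] := zP m; apply.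
have [b _ /(_ b (leqnn b)) Uz] := zx _ xU.
by have [_] := zP b; apply.
Qed.

Lemma separated_nbhs (Y X : topologicalType) (f g : Y -> X) (x : Y) :
  hausdorff_space X -> {for x, continuous f} -> {for x, continuous g} ->
  f x <> g x ->
  exists2 U, nbhs x U & forall y z, U y -> U z -> f y <> g z.
Proof.
rewrite open_hausdorff => hX cf cg /eqP/hX[[A B] /= [Afx Bgx] [oA oB /eqP AB]].
rewrite !inE in Afx Bgx.
exists (f @^-1` A `&` g @^-1` B).
  apply: filterI.
  - by apply: cf; exact: open_nbhs_nbhs.
  - by apply: cg; exact: open_nbhs_nbhs.
move=> y z [Ay _] [_ Bz] fg.
have : (A `&` B) (f y) by split => //; rewrite fg.
by rewrite AB.
Qed.

Lemma iter_shift j (x : cantor_space) n : iter j shift x n = x (j + n)%N.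
Proof. by elim: j n => //= j IH n; rewrite /shift IH addnS. Qed.

Lemma iter_iter (A : Type) m n (f : A -> A) x :
  iter m (iter n f) x = iter (m * n) f x.
Proof. by elim: m => //= m ->; rewrite mulSn iterD. Qed.

Lemma continuous_iter (Y : topologicalType) (f : Y -> Y) n :
  continuous f -> continuous (iter n f).
Proof.
move=> cf; elim: n => [|n IH] x /=; first exact: cvg_id.
by apply: (@continuous_comp _ _ _ (iter n f) f); [exact: IH|exact: cf].
Qed.

(** * Coding by marked blocks *)

Definition pulse (p : nat) : cantor_space := fun n => (p %| n)%N.

(* The word 11 marks the starts of the blocks of length M: for 5 <= p it occurs
   exactly at the multiples of M. The n-th block carries the free symbol a n. *)
Definition encode (p M : nat) (a : cantor_space) : cantor_space :=
  fun n => [|| p %| n, n %% M == 1 | (n %% M == 3) && a (n %/ M)]%N.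

(** The free symbol sits at offset 3: for [5 <= p] offsets 2 and 4 carry 0, so a free 1 never
    creates a second word 11. *)
Definition decode (M : nat) (x : cantor_space) : cantor_space :=
  fun n => x (n * M + 3)%N.

Lemma encodeK p M a : (4 <= p)%N -> (p %| M)%N -> (0 < M)%N ->
  decode M (encode p M a) = a.
Proof.
move=> p4 pM M0; apply: funext => n; rewrite /decode /encode.
have pleM := dvdn_leq M0 pM.
have M3 : (3 < M)%N by lia.
rewrite dvdn_addr ?dvdn_mull // gtnNdvd //= modnMDl modn_small //=.
by rewrite divnMDl // divn_small // addn0.
Qed.

(** This is what makes the M-th iterate of S act on K as the full shift. *)
Lemma encode_shift p M a : (p %| M)%N -> (0 < M)%N ->
  encode p M (shift a) = iter M shift (encode p M a).
Proof.
move=> pM M0; apply: funext => n; rewrite iter_shift /encode /shift.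
by rewrite dvdn_addr // modnDl divnDl // divnn M0.
Qed.

Lemma encode_continuous p M : continuous (encode p M).
Proof.
apply: cantor_continuousP => n; exists (n %/ M).+1 => x y xy.
by rewrite /encode xy.
Qed.

Lemma decode_continuous M : continuous (decode M).
Proof.
apply: cantor_continuousP => n; exists (n * M + 3).+1 => x y xy.
by rewrite /decode xy.
Qed.

Lemma encode_marker p M a j : (5 <= p)%N -> (p %| M)%N -> (0 < M)%N ->
  encode p M a j -> encode p M a j.+1 -> (M %| j)%N.
Proof.
move=> p5 pM M0; rewrite /encode.
have pleM := dvdn_leq M0 pM.
have dvdp_modM n : (p %| n)%N = (p %| n %% M)%N by rewrite /dvdn modn_dvdm.
have dvdpS n : (p %| n -> p %| n.+1 -> False)%N.
  by move=> pn; rewrite -addn1 dvdn_addr // dvdn1; lia.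
rewrite (dvdp_modM j) (dvdp_modM j.+1) -(addn1 j) -modnDml addn1 /(dvdn M).
have := ltn_pmod j M0; move: (j %% M)%N => s sM.
case: (posnP s) => // s0 H1 H2; exfalso.
(* The last offset of a block must be ruled out separately, since its successor wraps around to the
   1 at offset 0. *)
have sM1 : (s.+1 < M)%N.
  rewrite ltn_neqAle sM andbT; apply/eqP => sE.
  have ps1 : (p %| s.+1)%N by rewrite sE.
  move: H1 => /or3P[ps|/eqP s1|/andP[/eqP s3 _]]; [exact: dvdpS ps ps1| |]; lia.
move: H2; rewrite modn_small // => H2.
have small n : (0 < n -> n < p -> p %| n -> False)%N.
  by move=> n0 np; rewrite gtnNdvd.
case/or3P: H1 => [ps|/eqP s1|/andP[/eqP s3 _]].
- have sp := dvdn_leq s0 ps.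
  by case/or3P: H2 => [/(dvdpS _ ps)//|/eqP|/andP[/eqP]]; lia.
- by case/or3P: H2 => [/small|/eqP|/andP[/eqP]]; lia.
- by case/or3P: H2 => [/small|/eqP|/andP[/eqP]]; lia.
Qed.

(** Beyond the first p entries of a block, the marker and the free symbol are passed and only the
    multiples of p carry a 1. *)
Lemma encode_window p M a b m n : (5 <= p)%N -> (p %| M)%N -> (p %| m)%N ->
  (p <= m %% M)%N -> (m %% M + b <= M)%N -> (n < b)%N ->
  encode p M a (m + n)%N = pulse p n.
Proof.
move=> p5 pM pm pleM mbM nb; rewrite /encode /pulse dvdn_addr //.
have -> : ((m + n) %% M = m %% M + n)%N by rewrite -modnDml modn_small //; lia.
have /negPf -> : (m %% M + n != 1)%N by lia.
have /negPf -> : (m %% M + n != 3)%N by lia.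
by rewrite !orbF.
Qed.

(* For a phase shift j, some i puts both i and i + j in the part of the block,
   counted in units of p, where the sequence agrees with the pulse. *)
Lemma two_windows t b j : (2 * b + 1 <= t)%N -> (0 < b)%N ->
  exists i, [/\ 1 <= i %% t, i %% t + b <= t, 1 <= (i + j) %% t &
               (i + j) %% t + b <= t]%N.
Proof.
move=> tb b0; suff [i [u [v [iu jv u1 ub]]]] : exists i u v,
    [/\ i %% t = u, (i + j) %% t = v, 1 <= u <= t - b & 1 <= v <= t - b]%N.
  by exists i; rewrite iu jv; split; lia.
have : (j %% t < t)%N by rewrite ltn_mod; lia.
have modD i : ((i + j) %% t = (i + j %% t) %% t)%N by rewrite modnDmr.
move: (j %% t)%N modD => s modD st.
have [jb|jb] := leqP (s + 1 + b) t.
  exists 1%N, 1%N, (1 + s)%N; rewrite modD !modn_small; [split|..]; lia.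
(* Here [i + s] wraps around to 1, and [i <= b + 1 <= t - b]; this is where [2 * b + 1 <= t]
   enters. *)
exists (t - s + 1)%N, (t - s + 1)%N, 1%N.
have ts : (t - s + 1 + s = t + 1)%N by lia.
by rewrite modD ts modnDl !modn_small; [split|..]; lia.
Qed.

(** * Return times of the horseshoe *)

Section Horseshoe.
Variables (X : topologicalType) (T : X -> X) (N : nat) (k : cantor_space -> X).
Hypotheses (hausX : hausdorff_space X) (cT : continuous T) (ck : continuous k).
Hypotheses (k_inj : injective k) (kS : forall y, iter N T (k y) = k (shift y)).

Lemma conj_iter_shift j y : iter (j * N) T (k y) = k (iter j shift y).
Proof. by rewrite -iter_iter; elim: j => //= j ->; rewrite kS. Qed.

(* T^n commutes with T^N, so T^n x = x gives (T^N)^n x = x: the return time n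
   is a multiple of the T^N-period p of x, hence of N. *)
Lemma pulse_return p n : (N %| p)%N ->
  iter n T (k (pulse p)) = k (pulse p) -> (N %| n)%N.
Proof.
move=> Np Tn; apply: (dvdn_trans Np).
have : iter (n * N) T (k (pulse p)) = k (pulse p).
  by rewrite mulnC -iter_iter; elim: N => //= m ->.
rewrite conj_iter_shift => /k_inj/(congr1 (@^~ 0%N)).
by rewrite iter_shift addn0 /pulse dvdn0.
Qed.

Lemma pulse_cylinder_separated p q : (N %| p)%N ->
  exists b, forall y z, (forall n, (n < b)%N -> y n = pulse p n) ->
    (forall n, (n < b)%N -> z n = pulse p n) ->
    forall n, (n < q)%N -> ~~ (N %| n)%N -> iter n T (k y) <> k z.
Proof.
move=> Np.
have sep (i : 'I_q) : exists b, ~~ (N %| i)%N -> forall y z,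
    (forall n, (n < b)%N -> y n = pulse p n) ->
    (forall n, (n < b)%N -> z n = pulse p n) -> iter i T (k y) <> k z.
  have [?|Ni] := boolP (N %| i)%N; first by exists 0%N.
  have cTk : continuous (iter i T \o k).
    move=> y; apply: continuous_comp; first exact: ck.
    exact: continuous_iter.
  have ne : (iter i T \o k) (pulse p) <> k (pulse p).
    by move=> /(pulse_return Np); apply/negP.
  have [U Up Usep] := separated_nbhs hausX (@cTk _) (@ck _) ne.
  have [b bU] := cylinder_sub_nbhs Up.
  by exists b => _ y z yb zb; apply: Usep; exact: bU.
have [B BP] := choice sep.
(* Only finitely many times n are excluded, so one prefix length serves them all. *)
exists (\max_i B i) => y z yb zb n nq Nn.
by apply: (BP (Ordinal nq)) => // m mB; [apply: yb|apply: zb];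
  exact: leq_trans mB (leq_bigmax (Ordinal nq)).
Qed.

Lemma encode_disjoint_steps : (0 < N)%N ->
  exists p M, [/\ (5 <= p)%N, (p %| M)%N, (0 < M)%N &
    disjoint_steps (M * N) T (range (k \o encode p M))].
Proof.
move=> N0; have [p p5 Np] : exists2 p, (5 <= p)%N & (N %| p)%N.
  by exists (5 * N)%N; [lia|exact: dvdn_mull].
(* The time excluded at the end is [r + l * N] with [r < N] and [l < p], hence below [p * N]. *)
have [b0 sep] := pulse_cylinder_separated (p * N)%N Np.
pose b := b0.+1; pose t := (2 * b + 1)%N; pose M := (p * t)%N.
have M0 : (0 < M)%N by rewrite muln_gt0; lia.
have pM : (p %| M)%N by rewrite dvdn_mulr.
exists p, M; split => //.
rewrite /disjoint_steps -subset0 => x [[a' _ <-] [s /= /andP[s1 sMN]]].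
move=> [_ [a _ <-] /= TE].
have {}sMN : (s < M * N)%N by lia.
have := divn_eq s N; set j := (s %/ N)%N; set r := (s %% N)%N => sE.
have rN : (r < N)%N by rewrite ltn_mod.
have jM : (j < M)%N by rewrite ltn_divLR.
have {}TE : iter r T (k (iter j shift (encode p M a))) = k (encode p M a').
  by rewrite -conj_iter_shift -iterD addnC -sE.
(* If N divides s, the marker at the start of the image sequence forces M to divide [j < M], so s
   would be 0. *)
have [r0|r0] := posnP r.
  move: TE; rewrite r0 => /= /k_inj yE.
  have e0 : encode p M a' 0%N by rewrite /encode dvdn0.
  have e1 : encode p M a' 1%N.
    have M1 : (1 < M)%N by have := dvdn_leq M0 pM; lia.
    by rewrite /encode (modn_small M1) eqxx orbT.
  have /(encode_marker p5 pM M0) : encode p M a j.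
    by rewrite -(addn0 j) -iter_shift yE.
  have ej1 : encode p M a j.+1 by rewrite -addn1 -iter_shift yE.
  move=> /(_ ej1) Mj; have [j0|j0] := posnP j; last first.
    by have := dvdn_leq j0 Mj; lia.
  by move: s1; rewrite sE r0 j0.
(* Otherwise apply S another [p * i] times: [encode p M a] is then read from [p * (i + j')] and
   [encode p M a'] from [p * i], both inside windows, and the time left over is [r + l * N], not
   divisible by N. *)
pose l := (j %% p)%N; pose j' := (j %/ p)%N.
have jE : (j = j' * p + l)%N by exact: divn_eq.
have lp : (l < p)%N by rewrite ltn_mod; lia.
have [//|i [i1 i2 ij1 ij2]] := @two_windows t b j' (leqnn _).
have window c m : (1 <= m %% t)%N -> (m %% t + b <= t)%N ->
    forall n, (n < b0)%N -> iter (p * m) shift (encode p M c) n = pulse p n.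
  move=> m1 m2 n nb; rewrite iter_shift.
  have pmM : ((p * m) %% M = p * (m %% t))%N by rewrite /M -muln_modr.
  have pm : (p %| p * m)%N by exact: dvdn_mulr.
  apply: (@encode_window p M c (p * b)); rewrite ?pmM //.
  - by rewrite leq_pmulr.
  - by rewrite -mulnDr leq_mul2l m2 orbT.
  - by apply: leq_trans nb (leq_trans (leqnSn b0) _); rewrite leq_pmull //; lia.
apply: (sep _ _ (window a _ ij1 ij2) (window a' _ i1 i2) (r + l * N)%N).
- by apply: (@leq_trans (l.+1 * N)); rewrite ?leq_mul2r ?lp ?orbT // mulSn ltn_add2r.
- by rewrite dvdn_addl ?dvdn_mull // gtnNdvd.
rewrite -!conj_iter_shift -TE -conj_iter_shift -!iterD.
by congr iter; rewrite jE; lia.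
Qed.

End Horseshoe.

Theorem theorem5p1 (R : realType) (X : metricType R) (T : X -> X)
    (hT : topological_dynamical_system T)
    (N : nat) (hN : (1 <= N)%N) (L : set X) (hL : horseshoe N T L) :
  exists (K : set X) (M : nat),
    [/\ closed K, K `<=` L, (0 < M)%N,
        horseshoe (M * N)%N T K & disjoint_steps (M * N)%N T K].
Proof.
have [_ cT] := hT.
have [_ TL [h [k [[ch ck Lk] [hK kK hS]]]]] := hL.
have hausX : hausdorff_space X by exact: metric_hausdorff.
have k_inj : injective k by exact: can_inj kK.
have kS y : iter N T (k y) = k (shift y).
  (* The point [iter N T (k y)] stays in [L], so [k] undoes [h] there. *)
  by rewrite -[LHS]hK ?hS ?kK //; apply: TL; exists (k y).
have [p [M [p5 pM M0 disj]]] := encode_disjoint_steps hausX cT ck k_inj kS hN.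
pose g := k \o encode p M.
have cg : continuous g.
  move=> y; apply: continuous_comp; first exact: encode_continuous.
  exact: ck.
have gL y : L (g y) by exact: Lk.
have eK y := encodeK y (ltnW p5) pM M0.
have gS y : iter (M * N) T (g y) = g (shift y).
  by rewrite /g /= (conj_iter_shift kS) encode_shift.
exists (range g), M.
have clK : closed (range g).
  apply: compact_closed => //; apply: continuous_compact.
    exact: continuous_subspaceT.
  exact: cantor_space_compact.
have KL : range g `<=` L by move=> _ [y _ <-].
split => //; split => //.
  by move=> _ [_ [y _ <-] <-]; rewrite gS; exists (shift y).
exists (decode M \o h), g; split; split => //.
- have chK := continuous_subspaceW KL ch.
  move=> x.
  apply: (@continuous_comp (subspace (range g)) _ _ h (decode M)).
    exact: chK.
  exact: decode_continuous.
- by move=> _ [y _ <-] /=; rewrite kK eK.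
- by move=> y /=; rewrite kK eK.
- by move=> _ [y _ <-]; rewrite gS /= !kK !eK.
Qed.
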